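(* Fix $0<c<\infty$ and let $m=cn^{3/2}$. Then as $n\to\infty$, $\|x_m-U\|_\infty\sim e^{1/(12c^2)}-1$ and $\mathrm{sep}(x_m)\sim 1-e^{-1/(24c^2)}$.
   Context: $x_m$ is the lazy $m$-shelf shuffling distribution on $S_n$: a deck of cards $1,\ldots,n$ (top to bottom) is processed in order $1,\ldots,n$; each card independently and uniformly chooses one of $2m+1$ options: shelf $0$ (placed below the cards already there), or one of shelves $1,\ldots,m$, placed either on top of or below the cards already there. The piles are then stacked with shelf $0$ on top, then shelf $1$, ..., shelf $m$; $x_m(\pi)$ is the probability that the card in position $i$ from the top is $\pi(i)$ for all $i$. $U$ is the uniform distribution on $S_n$; $\|\mathbb P-U\|_\infty=\max_{\pi\in S_n}|1-n!\,\mathbb P(\pi)|$ and $\mathrm{sep}(\mathbb P)=\max_{\pi\in S_n}(1-n!\,\mathbb P(\pi))$. *)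

(* Defs.v *)
From HB Require Import structures.
From mathcomp Require Import all_boot all_order all_algebra all_fingroup.
From mathcomp Require Import all_classical all_reals all_analysis.
Set Implicit Arguments. Unset Strict Implicit. Unset Printing Implicit Defensive.
Import Order.TTheory GRing.Theory Num.Theory.
Local Open Scope ring_scope.

(* Cards are 0,...,n-1 (i.e. card k+1 of the paper is the ordinal k).
   Each card chooses one of 2m+1 options, encoded as o : 'I_(2m+1):
     o = 0        : shelf 0, placed below the cards already there;
     o = 2k-1     : shelf k (1<=k<=m), placed on top of the cards there;
     o = 2k       : shelf k (1<=k<=m), placed below the cards there.
   A pile is a seq listed top to bottom. *)

Definition shelf_of (o : nat) : nat := (o.+1 %/ 2)%N.
Definition on_top (o : nat) : bool := odd o.

Definition place_card (n : nat) (piles : nat -> seq 'I_n) (i : 'I_n) (o : nat)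
  : nat -> seq 'I_n :=
  fun s => if s == shelf_of o then
             (if on_top o then i :: piles s else rcons (piles s) i)
           else piles s.

Definition shelf_deck (n m : nat) (f : {ffun 'I_n -> 'I_(2 * m).+1}) : seq 'I_n :=
  let piles := foldl (fun p (i : 'I_n) => place_card p i (f i))
                     (fun _ => [::]) (enum 'I_n) in
  flatten [seq piles s | s <- iota 0 m.+1].

Definition shelf_prob (R : realType) (n m : nat) (pi : 'S_n) : R :=
  (#|[set f : {ffun 'I_n -> 'I_(2 * m).+1} |
        shelf_deck f == [seq pi i | i <- enum 'I_n]]|)%:R
  / (((2 * m).+1) ^ n)%:R.

(* || P - U ||_infty = max_pi |1 - n! P(pi)|  (a max of nonnegative reals, so 0 is a harmless neutral element) *)
Definition linf_dist (R : realType) (n : nat) (P : 'S_n -> R) : R :=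
  \big[Order.max/0]_(pi : 'S_n) `|1 - (n`!)%:R * P pi|.

(* sep(P) = max_pi (1 - n! P(pi)); for a probability distribution this max is >= 0,
   so 0 is a harmless neutral element (S_n is nonempty anyway). *)
Definition sep_dist (R : realType) (n : nat) (P : 'S_n -> R) : R :=
  \big[Order.max/0]_(pi : 'S_n) (1 - (n`!)%:R * P pi).

Definition m_of (R : realType) (c : R) (n : nat) : nat :=
  Num.truncn (c * (n%:R `^ (3 / 2 : R))).

(* Main.v *)
Require Import Defs.
From HB Require Import structures.
From mathcomp Require Import all_boot all_order all_algebra all_fingroup.
From mathcomp Require Import all_classical all_reals all_analysis.
From mathcomp Require Import zify ring lra.
Import Order.TTheory GRing.Theory Num.Theory.
Import numFieldNormedType.Exports.

(** The shuffled deck lists the cards by increasing option, cards with the same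
    option appearing in increasing order if the option is even and in decreasing
    order if it is odd.  Hence the choices leading to [pi] correspond to weakly
    increasing words of options in which an option may be repeated at positions
    [i], [i + 1] only if its parity matches the descent of [pi] at [i].  Their
    number depends only on the descent word [w] of [pi] and obeys a recursion on
    [w] with nonnegative coefficients, which yields extremal words: it is largest
    for the identity and smallest for an alternating permutation.

    Write [N = 2m + 1].  For the identity the count is the Delannoy number
    [D(m, n)], whose three-term recurrence says that [u_n = n! D(m, n) / N^n]
    satisfies [u_(n+2) = u_(n+1) + ((n+1)/N)^2 u_n], so that [u_n] is close to
    [exp (n^3 / (3 N^2))].  For an alternating permutation [n!] times the
    probability is the product of the [1 - ((2i+1)/N)^2] over [i < n/2], close to
    [exp (- n^3 / (6 N^2))].  When [m ~ c n^(3/2)], [n^3 / N^2] tends to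
    [1 / (4 c^2)]. *)

(** * The shuffled deck as a sorted list *)

(** Slots are pairs (option, card). Cards with a common odd option are each put on top of the
    earlier ones, hence the reversed comparison. *)
Definition slot_lt (x y : nat * nat) : bool :=
  (x.1 < y.1) || (x.1 == y.1) && (if odd x.1 then y.2 < x.2 else x.2 < y.2).

Lemma slot_lt_trans : transitive slot_lt.
Proof.
move=> [b1 b2] [a1 a2] [c1 c2]; rewrite /slot_lt /=.
case/orP=> [ab|/andP[/eqP<- ab]] /orP[bc|/andP[/eqP<- bc]]; apply/orP.
- by left; apply: ltn_trans bc.
- by left.
- by left.
- by right; rewrite eqxx; move: ab bc; case: odd; lia.
Qed.

Lemma slot_lt_irr : irreflexive slot_lt.
Proof. by move=> [a b]; rewrite /slot_lt /= ltnn eqxx ltnn; case: odd. Qed.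

Section Deck.
Variables (n m : nat) (f : {ffun 'I_n -> 'I_(2 * m).+1}).

Let slot (i : 'I_n) : nat * nat := (val (f i), val i).
Let r := relpre slot slot_lt.
Let r_trans : transitive r.
Proof. by move=> j i l; apply: slot_lt_trans. Qed.

Let r_irr : irreflexive r.
Proof. by move=> i; apply: slot_lt_irr. Qed.

Let pile (k : nat) : seq 'I_n :=
  rev [seq i <- enum 'I_n | (shelf_of (f i) == k) && odd (f i)]
  ++ [seq i <- enum 'I_n | (shelf_of (f i) == k) && ~~ odd (f i)].

Lemma shelf_deckE : shelf_deck f = flatten [seq pile k | k <- iota 0 m.+1].
Proof.
rewrite /shelf_deck; congr flatten; apply: eq_map => k.
(* Arbitrary initial piles [p0] make the induction work: new cards wrap around [p0 k] on both
   sides. *)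
suff H s p0 : foldl (fun p (i : 'I_n) => place_card p i (f i)) p0 s k =
    rev [seq i <- s | (shelf_of (f i) == k) && odd (f i)] ++ p0 k
    ++ [seq i <- s | (shelf_of (f i) == k) && ~~ odd (f i)] by rewrite H.
elim: s p0 => [|i s IH] p0 /=; first by rewrite cats0.
rewrite IH /place_card /on_top [k == _]eq_sym.
case: eqP => //= _; case: odd => /=; first by rewrite rev_cons cat_rcons.
by rewrite cat_rcons.
Qed.

Lemma mem_pile k i : (i \in pile k) = (shelf_of (f i) == k).
Proof.
rewrite mem_cat mem_rev mem_filter mem_enum mem_filter mem_enum !andbT.
by rewrite -andb_orr orbN andbT.
Qed.

Lemma pairwise_pile k : pairwise r (pile k).
Proof.
have ltP : pairwise (fun i j : 'I_n => i < j) (enum 'I_n).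
  rewrite -(pairwise_map val ltn) val_enum_ord -sorted_pairwise ?iota_ltn_sorted //.
  exact: ltn_trans.
rewrite pairwise_cat; apply/and3P; split.
- apply/allrelP => i j; rewrite mem_rev mem_filter => /andP[/andP[/eqP + +] _].
  rewrite mem_filter => + + /andP[/andP[/eqP + +] _]; rewrite /r /slot_lt /= /shelf_of.
  lia.
- rewrite -sorted_pairwise // rev_sorted sorted_pairwise; last first.
    by move=> j i l ij jl; apply: r_trans ij.
  apply: (@sub_in_pairwise _ [pred i | (shelf_of (f i) == k) && odd (f i)])
    (pairwise_filter _ ltP).
    move=> i j /andP[/eqP si oi] /andP[/eqP sj oj] ij.
    (* Shelf and parity together determine the option. *)
    have e : f i = f j :> nat by move: si sj oi oj; rewrite /shelf_of; lia.
    by rewrite /r /slot_lt /= e eqxx ltnn ?oj ?(negbTE oj).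
  exact: filter_all.
- apply: (@sub_in_pairwise _ [pred i | (shelf_of (f i) == k) && ~~ odd (f i)])
    (pairwise_filter _ ltP).
    move=> i j /andP[/eqP si oi] /andP[/eqP sj oj] ij.
    have e : f i = f j :> nat by move: si sj oi oj; rewrite /shelf_of; lia.
    by rewrite /r /slot_lt /= e eqxx ltnn ?oj ?(negbTE oj).
  exact: filter_all.
Qed.

Lemma sorted_shelf_deck : sorted r (shelf_deck f).
Proof.
rewrite sorted_pairwise // shelf_deckE.
elim: m.+1 0 => [//|l IH] a /=; rewrite pairwise_cat pairwise_pile IH !andbT.
apply/allrelP => i j; rewrite mem_pile => /eqP + /flatten_mapP[k].
by rewrite mem_iota mem_pile => + + /eqP; rewrite /r /slot_lt /= /shelf_of; lia.
Qed.

Lemma mem_shelf_deck i : i \in shelf_deck f.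
Proof.
rewrite shelf_deckE; apply/flatten_mapP; exists (shelf_of (f i)); last by rewrite mem_pile.
by rewrite mem_iota /shelf_of; have := ltn_ord (f i); lia.
Qed.

(** A strict order admits only one sorted listing of a given set. *)
Lemma shelf_deck_eq s : s =i 'I_n -> (shelf_deck f == s) = sorted r s.
Proof.
move=> sT; apply/eqP/idP => [<-|ss]; first exact: sorted_shelf_deck.
apply: (irr_sorted_eq r_trans r_irr) => // [|i]; first exact: sorted_shelf_deck.
by rewrite sT mem_shelf_deck.
Qed.
End Deck.

(** * Counting option words with a given descent word *)

Lemma big_tuple_cons (T : finType) k (G : seq T -> nat) :
  \sum_(t : k.+1.-tuple T) G t = \sum_(o : T) \sum_(t : k.-tuple T) G (o :: t).
Proof.
rewrite pair_big /= (reindex (fun x : T * k.-tuple T => [tuple of x.1 :: x.2])) //=.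
exists (fun t : k.+1.-tuple T => (thead t, behead_tuple t)) => [ [u t] _|t _] /=.
  by congr pair; apply: val_inj.
by rewrite [RHS]tuple_eta.
Qed.

(* Number of option words for the cards with descent word [w] that start with
   option [2m - i]: the reflection of the options keeps parities and makes the
   recursion independent of [m]. *)
Fixpoint words_from (w : seq bool) (i : nat) : nat :=
  if w is d :: w' then \sum_(k < i) words_from w' k + (odd i == d) * words_from w' i else 1.

Definition words_below (w : seq bool) (x : nat) : nat := \sum_(k < x) words_from w k.

Definition descents (a : nat) (p : seq nat) : seq bool := pairmap (fun x y => y < x) a p.

Lemma count_path (m a : nat) (p : seq nat) (o : 'I_(2 * m).+1) : uniq (a :: p) ->
  \sum_(t : (size p).-tuple 'I_(2 * m).+1)
     path slot_lt (val o, a) (zip [seq val x | x <- t] p)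
  = words_from (descents a p) (2 * m - o).
Proof.
elim: p a o => [|b p IH] a o.
  move=> _; rewrite (bigD1 [tuple]) //= big1 ?addn0 // => t.
  by rewrite (tuple0 t) => /eqP.
move=> /= /and3P[]; rewrite inE negb_or => /andP[ab ap] bp up.
pose G (t : seq 'I_(2 * m).+1) : nat :=
  path slot_lt (val o, a) (zip [seq val x | x <- t] (b :: p)).
rewrite (big_tuple_cons _ _ G) /G /=.
transitivity (\sum_(o' < (2 * m).+1)
    slot_lt (val o, a) (val o', b) * words_from (descents b p) (2 * m - o')).
  apply: eq_bigr => o' _; rewrite -IH /= ?bp // big_distrr /=.
  by apply: eq_bigr => t _; case: slot_lt; rewrite ?mul1n.
(* The reflection k = 2m - o' turns the options above [o] into the k below 2m - o. *)
rewrite (reindex_inj rev_ord_inj) /=.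
have om : o <= 2 * m by rewrite -ltnS.
pose H k := ((k < 2 * m - o) + ((k == 2 * m - o) && (odd (2 * m - o) == (b < a))))
  * words_from (descents b p) k.
rewrite (eq_bigr (fun k : 'I_(2 * m).+1 => if k < (2 * m - o).+1 then H k else 0)); last first.
  move=> k _; rewrite subSS subKn; last by rewrite -ltnS.
  have km : k <= 2 * m by rewrite -ltnS.
  rewrite /slot_lt /H /= ltnS.
  have -> : (o < 2 * m - k) = (k < 2 * m - o) by lia.
  have -> : (o == 2 * m - k :> nat) = (k == 2 * m - o :> nat) by lia.
  have -> : odd (2 * m - o) = odd o by lia.
  case: ltngtP => //= _.
  by move: ab; case: odd; case: ltngtP.
rewrite -big_mkcond /=.
rewrite -(big_ord_widen _ H) ?ltnS ?leq_subr // /H.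
rewrite big_ord_recr /= ltnn eqxx add0n andTb; congr (_ + _).
by apply: eq_bigr => k _; rewrite ltn_ord (ltn_eqF (ltn_ord k)) mul1n.
Qed.


Lemma mem_perm_seq n (pi : 'S_n) : [seq pi i | i <- enum 'I_n] =i 'I_n.
Proof.
move=> i; rewrite inE; apply/mapP; exists ((pi^-1)%g i); first by rewrite mem_enum.
by rewrite permKV.
Qed.

Definition perm_word n (pi : 'S_n) : seq nat := [seq val (pi i) | i <- enum 'I_n].

Lemma card_shelf_deck n m (pi : 'S_n.+1) :
  #|[set f : {ffun 'I_n.+1 -> 'I_(2 * m).+1} | shelf_deck f == [seq pi i | i <- enum 'I_n.+1]]|
  = words_below (descents (head 0 (perm_word _ pi)) (behead (perm_word _ pi))) (2 * m).+1.
Proof.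
have wE : perm_word _ pi = head 0 (perm_word _ pi) :: behead (perm_word _ pi).
  by rewrite /perm_word enum_ordSl.
have uw : uniq (perm_word _ pi).
  by rewrite /perm_word map_inj_uniq ?enum_uniq // => i j /val_inj/perm_inj.
have sw : size (perm_word _ pi) = n.+1 by rewrite size_map size_enum_ord.
set a := head _ _ in wE *; set p := behead _ in wE *.
have sp : size p = n by move: sw; rewrite wE => -[].
transitivity (\sum_(t : n.+1.-tuple 'I_(2 * m).+1)
    sorted slot_lt (zip [seq val x | x <- t] (perm_word _ pi))); last first.
  rewrite wE.
  pose G (t : seq 'I_(2 * m).+1) : nat := sorted slot_lt (zip [seq val x | x <- t] (a :: p)).
  rewrite (big_tuple_cons _ _ G) /G /=.
  rewrite -sp.
  under eq_bigr => u _ do rewrite count_path -?wE //.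
  rewrite (reindex_inj rev_ord_inj) /words_below; apply: eq_bigr => k _ /=.
  by rewrite subSS subKn // -ltnS.
rewrite -sum1_card big_mkcond /=.
(* Options are read by position in the deck instead of by card. *)
rewrite (reindex (fun t : n.+1.-tuple 'I_(2 * m).+1 =>
    [ffun i => tnth t ((pi^-1)%g i)])) /=; last first.
  exists (fun f => [tuple f (pi i) | i < n.+1]) => [t _|f _].
    by apply: eq_from_tnth => i; rewrite tnth_mktuple ffunE permK.
  by apply/ffunP => i; rewrite ffunE tnth_mktuple permKV.
apply: eq_bigr => t _; rewrite inE shelf_deck_eq; last exact: mem_perm_seq.
set f := finfun _.
have -> : zip [seq val x | x <- t] (perm_word _ pi) =
    [seq (val (f i), val i) | i <- [seq pi i | i <- enum 'I_n.+1]].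
  rewrite /perm_word -{1}[tval t]map_tnth_enum -!map_comp zip_map.
  by apply: eq_map => i /=; rewrite ffunE permK.
by rewrite !sorted_map; case: sorted.
Qed.

(** * Two-step recursion and maximality of the all-ascent word *)

Lemma nat_ind2 (P : nat -> Prop) :
  P 0 -> P 1 -> (forall x, P x -> P x.+1 -> P x.+2) -> forall x, P x.
Proof.
move=> P0 P1 PS x; suff [] : P x /\ P x.+1 by [].
by elim: x => [//|x [Px Px1]]; split=> //; apply: PS.
Qed.

Lemma words_below_nil x : words_below [::] x = x.
Proof. by rewrite /words_below sum1_card card_ord. Qed.

Lemma words_below0 w : words_below w 0 = 0.
Proof. by rewrite /words_below big_ord0. Qed.

Lemma words_belowS w x : words_below w x.+1 = words_below w x + words_from w x.
Proof. by rewrite /words_below big_ord_recr. Qed.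

Lemma leq_words_below w x y : x <= y -> words_below w x <= words_below w y.
Proof.
move=> /subnK <-; elim: (y - x) => [//|k IH].
by rewrite addSn words_belowS; apply: leq_trans IH (leq_addr _ _).
Qed.

Lemma words_from_cons d w i : words_from (d :: w) i =
  if odd i == d then words_below w i.+1 else words_below w i.
Proof. by rewrite /= words_belowS; case: eqP; rewrite ?mul1n ?addn0. Qed.

Lemma words_below_cons1 d w : words_below (d :: w) 1 = if d then 0 else words_below w 1.
Proof. by rewrite words_belowS words_below0 words_from_cons words_below0; case: d. Qed.

(** Exactly one of x and x + 1 has the parity that [d] asks for, so a step of two has only two
    forms. Their coefficients are nonnegative, so bounds propagate along the word. *)
Lemma words_below_cons2 d w x : words_below (d :: w) x.+2 =
  words_below (d :: w) x +
  if odd x == d then 2 * words_below w x.+1 else words_below w x + words_below w x.+2.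
Proof.
rewrite 2!words_belowS !words_from_cons /= -addnA; congr (_ + _).
by case: odd; case: d => //=; rewrite mul2n addnn.
Qed.

(* Convexity of the ascending count; with [words_below_cons2] it makes the
   all-ascent word maximal. *)
Lemma words_below_asc_even k x : ~~ odd x ->
  2 * words_below (nseq k false) x.+1 =
  words_below (nseq k false) x + words_below (nseq k false) x.+2.
Proof.
case: k => [|k] ox; first by rewrite !words_below_nil; lia.
by rewrite /= !words_belowS !words_from_cons /= (negbTE ox) /=; lia.
Qed.

Lemma words_below_asc_odd k x : odd x ->
  2 * words_below (nseq k false) x.+1 <=
  words_below (nseq k false) x + words_below (nseq k false) x.+2.
Proof.
case: k => [|k] ox; first by rewrite !words_below_nil; lia.
rewrite /= !words_belowS !words_from_cons /= ox /=.
have := leq_words_below (nseq k false) x x.+2 (leqW (leqnSn x)); lia.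
Qed.

(** On the all-ascent word the two forms of the increment agree for even x, and for odd x convexity
    favours the one that an ascent takes. Prepending an ascent is thus always best. *)
Lemma words_below_le_asc w x : words_below w x <= words_below (nseq (size w) false) x.
Proof.
elim: w x => [//|d w IH] x; elim/nat_ind2: x => [||x IHx _]; first by rewrite !words_below0.
  by rewrite !words_below_cons1; case: d.
rewrite -[nseq _ _]/(false :: nseq (size w) false) in IHx *.
rewrite !words_below_cons2; apply: leq_add => //.
have := IH x; have := IH x.+1; have := IH x.+2.
have := words_below_asc_even (size w) x; have := words_below_asc_odd (size w) x.
case: odd => /= h1 h2; [have := h1 isT | have := h2 isT]; case: (d) => /=; lia.
Qed.

(** * Delannoy numbers and their three-term recurrence *)

(** An ascending deck of n cards has n - 1 ascents; the value 1 at n = 0 completes the Delannoy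
    recurrence [delannoySS]. *)
Definition delannoy (m n : nat) : nat :=
  if n is k.+1 then words_below (nseq k false) (2 * m).+1 else 1.

Lemma delannoy0n n : delannoy 0 n = 1.
Proof.
case: n => [//|k]; rewrite /delannoy muln0.
by elim: k => [|k IH]; rewrite ?words_below_nil //= words_below_cons1.
Qed.

Lemma delannoySS m n :
  delannoy m.+1 n.+1 = delannoy m n.+1 + delannoy m.+1 n + delannoy m n.
Proof.
have e : (2 * m.+1).+1 = (2 * m).+3 by lia.
rewrite /delannoy e; case: n => [|n]; first by rewrite !words_below_nil; lia.
rewrite -[nseq n.+1 _]/(false :: nseq n false) words_below_cons2.
have -> : odd (2 * m).+1 = true by lia.
by rewrite /=; lia.
Qed.

Lemma delannoym1 m : delannoy m 1 = (2 * m).+1.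
Proof. by rewrite /delannoy words_below_nil. Qed.

(** Induction on m: the recurrence in row m gives the relation [Q] between rows m and m + 1, and
    both together give the recurrence in row m + 1. *)
Lemma delannoy_rec m n :
  n.+2 * delannoy m n.+2 = (2 * m).+1 * delannoy m n.+1 + n.+1 * delannoy m n.
Proof.
elim: m n => [|m P] n; first by rewrite !delannoy0n; lia.
have Q k : m.+1 * delannoy m.+1 k.+1 = (m + k).+2 * delannoy m k.+1 + k.+1 * delannoy m k.
  elim: k => [|k IH]; first by rewrite !delannoym1 /=; nia.
  rewrite delannoySS !mulnDr IH.
  by have := P k; lia.
have := P n; have := Q n.+1; rewrite !delannoySS; lia.
Qed.

(** * Permutations realising the extremal descent words *)

(** The alternation is anchored at the last letter, a descent, so that every tail is again of this
    form. *)
Fixpoint alt_word (k : nat) : seq bool := if k is l.+1 then ~~ odd l :: alt_word l else [::].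

Lemma nth_descents a p i : i < size p ->
  nth false (descents a p) i = (nth 0 p i < nth 0 (a :: p) i).
Proof. by move=> ip; rewrite (nth_pairmap 0). Qed.

Definition perm_descents n (pi : 'S_n.+1) : seq bool :=
  descents (head 0 (perm_word _ pi)) (behead (perm_word _ pi)).

Lemma size_perm_descents n (pi : 'S_n.+1) : size (perm_descents n pi) = n.
Proof. by rewrite size_pairmap size_behead size_map size_enum_ord. Qed.

Lemma perm_descents_eq n (pi : 'S_n.+1) (w : seq bool) : size w = n ->
  (forall i j : 'I_n.+1, j = i.+1 :> nat -> nth false w i = (pi j < pi i)) ->
  perm_descents n pi = w.
Proof.
move=> sw H; apply: (@eq_from_nth _ false); rewrite size_perm_descents ?sw // => i lin.
rewrite nth_descents; last by rewrite size_behead size_map size_enum_ord.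
have pE k (lk : k < n.+1) : nth 0 (perm_word _ pi) k = pi (Ordinal lk).
  rewrite (nth_map ord0) ?size_enum_ord //; congr (val (pi _)).
  by apply: val_inj; rewrite /= nth_enum_ord.
have lin1 : i < n.+1 by apply: ltnW.
have lin2 : i.+1 < n.+1 by [].
rewrite (H (Ordinal lin1) (Ordinal lin2)) // -!pE nth_behead.
by rewrite /perm_word enum_ordSl.
Qed.

Lemma perm_descents1 n : perm_descents n 1 = nseq n false.
Proof.
apply: perm_descents_eq; rewrite ?size_nseq // => i j ji.
by rewrite nth_nseq if_same !perm1 ji ltnNge leqnSn.
Qed.

Lemma nth_alt_word k i : i < k -> nth false (alt_word k) i = odd (k - i).
Proof. by elim: k i => [//|k IH] [|i] //= ik; rewrite IH. Qed.

Lemma size_alt_word k : size (alt_word k) = k.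
Proof. by elim: k => //= k ->. Qed.

Lemma exists_perm_alt_word n : exists pi : 'S_n.+1, perm_descents n pi = alt_word n.
Proof.
(* Read from the last position backwards, the values are 0, n, 1, n - 1, 2, ... *)
pose g (i : nat) := if odd (n - i) then n - (n - i)./2 else (n - i)./2.
have gn (i : 'I_n.+1) : g i < n.+1 by rewrite /g; case: ifP; lia.
have g_inj : injective (fun i : 'I_n.+1 => Ordinal (gn i)).
  move=> i j [gij]; apply: val_inj => /=; move: gij.
  have := ltn_ord i; have := ltn_ord j.
  by rewrite /g; do 2 case: ifP; lia.
exists (perm g_inj); apply: perm_descents_eq; rewrite ?size_alt_word // => i j ji.
have := ltn_ord j; rewrite ji ltnS => lin; rewrite nth_alt_word // !permE /= ji /g.
by do 2 case: ifP; lia.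
Qed.

(** * Central factorials and minimality of the alternating word *)

Local Open Scope ring_scope.

(* Central factorial [(x + n - 1)(x + n - 3) ... (x - n + 1)]. *)
Fixpoint central_fact (n : nat) (x : int) : int :=
  match n with
  | 0 => 1
  | 1 => x
  | (k.+1 as l).+1 => (x ^+ 2 - l%:Z ^+ 2) * central_fact k x
  end.

Lemma central_factSS n x : central_fact n.+2 x = (x ^+ 2 - n.+1%:Z ^+ 2) * central_fact n x.
Proof. by []. Qed.

(** The factors advance by 2, so those at x + 1 are the ones at x with one more on top. *)
Lemma central_fact_up n x : central_fact n.+1 (x + 1) = (x + n.+1%:Z) * central_fact n x.
Proof.
elim/nat_ind2: n => [||n IH _]; rewrite ?central_factSS ?IH /=; ring.
Qed.

Lemma central_fact_down n x : central_fact n.+1 (x - 1) = (x - n.+1%:Z) * central_fact n x.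
Proof.
elim/nat_ind2: n => [||n IH _]; rewrite ?central_factSS ?IH /=; ring.
Qed.

(** By size and parity, one of the factors is zero. *)
Lemma central_fact_eq0 n (y : nat) : (y < n)%N -> odd (n + y) -> central_fact n y%:Z = 0.
Proof.
elim/nat_ind2: n => [||n IH _] //=; first by case: y.
move=> yn oy; have [ln|] := ltnP y n; first by rewrite IH ?mulr0 //; lia.
move=> ny; have -> : y = n.+1 by lia.
by rewrite subrr mul0r.
Qed.

Lemma central_fact_ge0 n (y : nat) : odd (n + y) -> 0 <= central_fact n y%:Z.
Proof.
elim/nat_ind2: n => [||n IH _] //= oy; have [ln|ny] := ltnP y n.
  by rewrite central_fact_eq0 ?mulr0 //; lia.
apply: mulr_ge0; last by apply: IH; lia.
by rewrite subr_ge0 ler_sqr ?nnegrE //; lia.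
Qed.

Arguments central_fact : simpl never.

(* [(k + 1)!] times the number of words for the alternating descent word of
   length [k]; the other parity class is the mean of [central_fact k.+1] at
   [x + 1] and [x - 1]. *)
Definition min_count (k x : nat) : int :=
  if odd (k + x) then x%:Z * central_fact k x%:Z else central_fact k.+1 x%:Z.

(** This is the doubled form of [words_below_cons2], valid for both parities; the factor k + 2 is (k
    + 2)! / (k + 1)!. *)
Lemma min_count_mismatch k x :
  min_count k.+1 x.+2 = min_count k.+1 x + k.+2%:Z * (2 * min_count k x.+1).
Proof.
rewrite /min_count !addnS addSn /= !negbK.
have -> : x.+2%:Z = x.+1%:Z + 1 by lia.
have -> : x%:Z = x.+1%:Z - 1 by lia.
case: odd => /=; rewrite ?(central_fact_up k) ?(central_fact_down k) ?(central_fact_up k.+1)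
  ?(central_fact_down k.+1); ring.
Qed.

Lemma min_count_match_even k x : ~~ odd (k + x) ->
  min_count k.+1 x.+2 = min_count k.+1 x + k.+2%:Z * (min_count k x + min_count k x.+2).
Proof.
move=> o; rewrite min_count_mismatch; congr (_ + _ * _).
rewrite /min_count !addnS /= (negbTE o) /=.
have -> : x.+2%:Z = x.+1%:Z + 1 by lia.
have -> : x%:Z = x.+1%:Z - 1 by lia.
rewrite central_fact_up central_fact_down; ring.
Qed.

(** For these parities the other form of the increment exceeds the doubled one by a nonnegative
    multiple of a central factorial. *)
Lemma min_count_match_odd k x : odd (k + x) ->
  min_count k.+1 x.+2 <= min_count k.+1 x + k.+2%:Z * (min_count k x + min_count k x.+2).
Proof.
move=> o; rewrite min_count_mismatch lerD2l ler_wpM2l //.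
rewrite /min_count !addnS /= o /=.
case: k o => [|k] o; first by rewrite /central_fact; lia.
have c0 : 0 <= central_fact k x.+1 by apply: central_fact_ge0; lia.
have -> : x.+2%:Z = x.+1%:Z + 1 by lia.
have {1 2}-> : x%:Z = x.+1%:Z - 1 by lia.
rewrite central_fact_up central_fact_down central_factSS -subr_ge0.
set y := x.+1%:Z in c0 *.
have -> : (y - 1) * ((y - k.+1%:Z) * central_fact k y) +
   (y + 1) * ((y + k.+1%:Z) * central_fact k y) - 2 * ((y ^+ 2 - k.+1%:Z ^+ 2) * central_fact k y)
   = 2 * (k.+1%:Z ^+ 2 + k.+1%:Z) * central_fact k y by ring.
by apply: mulr_ge0 => //; lia.
Qed.

Lemma min_count0 k : min_count k 0 = 0.
Proof.
rewrite /min_count; case: ifP => [|o]; first by rewrite mul0r.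
by rewrite central_fact_eq0 //; lia.
Qed.

Lemma min_count1 k : min_count k.+1 1 = 0.
Proof.
by rewrite /min_count; case: ifP => o; rewrite central_fact_eq0 ?mulr0 //; lia.
Qed.

Lemma min_count_nil x : min_count 0 x = x.
Proof. by rewrite /min_count /central_fact mulr1; case: ifP. Qed.

(** [min_count] satisfies the doubled form of [words_below_cons2] exactly and the other form with an
    inequality, so it stays below whichever letters occur. *)
Lemma min_count_le_words_below w x :
  min_count (size w) x <= ((size w).+1`! * words_below w x)%:Z.
Proof.
elim: w x => [|d w IH] x; first by rewrite mul1n words_below_nil min_count_nil.
elim/nat_ind2: x => [||x IHx _]; first by rewrite min_count0.
  by rewrite min_count1.
have h y : (size w).+2%:Z * min_count (size w) y <= ((size w).+2`! * words_below w y)%:Z.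
  by rewrite factS -mulnA PoszM ler_wpM2l.
rewrite words_below_cons2 mulnDr PoszD; case: ifP => _.
  rewrite min_count_mismatch lerD // mulnCA PoszM.
  by rewrite [leLHS]mulrCA ler_wpM2l.
have min_countS : min_count (size w).+1 x.+2 <=
    min_count (size w).+1 x + (size w).+2%:Z * (min_count (size w) x + min_count (size w) x.+2).
  have [kx|kx] := boolP (odd (size w + x)); first exact: min_count_match_odd.
  by rewrite min_count_match_even.
apply: (le_trans min_countS); rewrite lerD // mulnDr PoszD mulrDr.
by rewrite lerD.
Qed.

(** The alternating word takes the doubled form exactly when k + x is odd; when k + x is even the
    two forms agree on [min_count]. Equality therefore persists. *)
Lemma words_below_alt_word k x : ((k.+1)`! * words_below (alt_word k) x)%:Z = min_count k x.
Proof.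
elim: k x => [|k IH] x; first by rewrite mul1n words_below_nil min_count_nil.
elim/nat_ind2: x => [||x IHx _]; first by rewrite min_count0 words_below0 muln0.
  rewrite min_count1 /= words_below_cons1; case: ifP => [|o]; first by rewrite muln0.
  move: (IH 1%N); case: k o {IH} => // k o; rewrite min_count1 => h.
  by rewrite factS -mulnA PoszM h mulr0.
rewrite [alt_word _]/= words_below_cons2 mulnDr PoszD IHx.
have h y : (k.+2 `! * words_below (alt_word k) y)%:Z = k.+2%:Z * min_count k y.
  by rewrite -IH factS -mulnA PoszM.
have [kx|kx] := boolP (odd (k + x)).
  have -> : odd x == ~~ odd k by move: kx; rewrite oddD; case: odd; case: odd.
  by rewrite min_count_mismatch mulnCA PoszM h mulrCA.
have -> : odd x == ~~ odd k = false by move: kx; rewrite oddD; case: odd; case: odd.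
by rewrite min_count_match_even // mulnDr PoszD !h mulrDr.
Qed.

(** * Extremal normalised probabilities and the two distances *)

Section Normalised.
Variable R : realType.

Definition upper (m n : nat) : R :=
  n`!%:R * (delannoy m n)%:R / (2 * m).+1%:R ^+ n.

Definition lower (m n : nat) : R :=
  \prod_(i < n./2) (1 - ((2 * i).+1%:R / (2 * m).+1%:R) ^+ 2).

Lemma central_fact_double (m j : nat) :
  (central_fact j.*2 (2 * m).+1%:Z)%:~R =
  (2 * m).+1%:R ^+ j.*2 * lower m j.*2 :> R.
Proof.
rewrite /lower doubleK; elim: j => [|j IH].
  by rewrite big_ord0 mulr1.
rewrite big_ord_recr /= doubleS central_factSS intrM IH rmorphB /= !rmorphXn /= -!pmulrn -mul2n.
have N0 : (2 * m).+1%:R != 0 :> R by rewrite pnatr_eq0.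
rewrite [X in _ = X * _]exprS [in RHS]exprS; set N := (2 * m).+1%:R in N0 *.
by set b := (2 * j).+1%:R; field.
Qed.

(** As N = 2m + 1 is odd, both cases of [min_count] involve a central factorial of even degree,
    whose factors pair into N^2 - (2i+1)^2; for even k a single factor N remains. *)
Lemma min_count_lower (m k : nat) :
  (min_count k (2 * m).+1)%:~R = (2 * m).+1%:R ^+ k.+1 * lower m k.+1 :> R.
Proof.
have [e|e] := boolP (odd k).
  have -> : k.+1 = (k.+1)./2.*2 by lia.
  rewrite -central_fact_double; congr (_%:~R).
  have -> : ((k.+1)./2.*2 = k.+1)%N by lia.
  by rewrite /min_count addnS /= oddD e /= mul2n odd_double.
rewrite /min_count addnS /= oddD (negbTE e) mul2n odd_double /= -mul2n.
have {1}-> : k = k./2.*2 by lia.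
rewrite intrM central_fact_double mulrA -exprS.
have -> : k./2.*2 = k by lia.
by congr (_ * _); rewrite /lower; have -> : ((k.+1)./2 = k./2)%N by lia.
Qed.

Lemma options_gt0 m : 0 < (2 * m).+1%:R :> R. Proof. by rewrite ltr0n. Qed.

Lemma shelf_probE n m (pi : 'S_n.+1) :
  shelf_prob R m pi = (words_below (perm_descents n pi) (2 * m).+1)%:R / (2 * m).+1%:R ^+ n.+1.
Proof. by rewrite /shelf_prob card_shelf_deck natrX. Qed.

Lemma shelf_prob_le n m (pi : 'S_n.+1) : n.+1`!%:R * shelf_prob R m pi <= upper m n.+1.
Proof.
rewrite shelf_probE /upper -mulrA ler_wpM2l // ler_wpM2r ?invr_ge0 ?exprn_ge0 //.
by rewrite ler_nat /delannoy -{2}(size_perm_descents n pi) words_below_le_asc.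
Qed.

Lemma shelf_prob1 n m : n.+1`!%:R * shelf_prob R m (1 : 'S_n.+1) = upper m n.+1.
Proof. by rewrite shelf_probE perm_descents1 mulrA. Qed.

Lemma shelf_prob_ge n m (pi : 'S_n.+1) : lower m n.+1 <= n.+1`!%:R * shelf_prob R m pi.
Proof.
rewrite shelf_probE mulrA ler_pdivlMr ?exprn_gt0 ?options_gt0 // mulrC -min_count_lower -natrM.
rewrite pmulrn ler_int.
by have := min_count_le_words_below (perm_descents n pi) (2 * m).+1; rewrite size_perm_descents.
Qed.

Lemma shelf_prob_min n m : exists pi : 'S_n.+1, n.+1`!%:R * shelf_prob R m pi = lower m n.+1.
Proof.
have [pi piE] := exists_perm_alt_word n; exists pi.
rewrite shelf_probE piE mulrA; apply: (canLR (mulfK _)).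
  by rewrite expf_neq0 ?gt_eqF ?options_gt0.
by rewrite [RHS]mulrC -min_count_lower -words_below_alt_word -natrM pmulrn.
Qed.

Lemma sep_shelf n m : lower m n.+1 <= 1 ->
  sep_dist (@shelf_prob R n.+1 m) = 1 - lower m n.+1.
Proof.
move=> l1; apply/le_anti/andP; split.
  (* The hypothesis serves to dominate the default value 0 of the maximum. *)
  by apply: bigmax_le => [|pi _]; rewrite ?subr_ge0 // lerB // shelf_prob_ge.
have [pi <-] := shelf_prob_min n m.
exact: (le_bigmax _ (fun pi => 1 - n.+1`!%:R * shelf_prob R m pi)).
Qed.

Lemma linf_shelf n m : lower m n.+1 <= 1 -> 1 <= upper m n.+1 ->
  linf_dist (@shelf_prob R n.+1 m) = Num.max (upper m n.+1 - 1) (1 - lower m n.+1).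
Proof.
move=> l1 u1; apply/le_anti/andP; split.
  apply: bigmax_le => [|pi _]; first by rewrite le_max subr_ge0 u1.
  have := shelf_prob_le n m pi; have := shelf_prob_ge n m pi.
  set v := _ * shelf_prob _ _ _ => lv vu; rewrite le_max.
  have [v1|v1] := leP v 1.
    by apply/orP; right; rewrite ger0_norm ?subr_ge0 // lerB.
  by apply/orP; left; rewrite ltr0_norm ?subr_lt0 // opprB lerB.
have bm pi := le_bigmax (0 : R) (fun pi : 'S_n.+1 => `|1 - n.+1`!%:R * shelf_prob R m pi|) pi.
rewrite ge_max; apply/andP; split.
  apply: le_trans (bm 1%g); rewrite shelf_prob1 distrC; exact: ler_norm.
have [pi piE] := shelf_prob_min n m.
by apply: le_trans (bm pi); rewrite piE; exact: ler_norm.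
Qed.

(** * Exponential bounds for the identity *)

Lemma upper_rec m n :
  upper m n.+2 = upper m n.+1 + (n.+1%:R / (2 * m).+1%:R) ^+ 2 * upper m n.
Proof.
have N0 := options_gt0 m; have h : (n.+2)%:R * (delannoy m n.+2)%:R =
  (2 * m).+1%:R * (delannoy m n.+1)%:R + n.+1%:R * (delannoy m n)%:R :> R.
  by rewrite -!natrM -natrD delannoy_rec.
rewrite /upper factS natrM [X in X * (delannoy m _)%:R]mulrC -[_ * _ * (delannoy m n.+2)%:R]mulrA h.
rewrite factS natrM !exprS; move: (2 * m).+1%:R N0 {h} => N N0; field.
by rewrite expf_neq0 gt_eqF.
Qed.

Lemma upper0 m : upper m 0 = 1.
Proof. by rewrite /upper /= expr0 divr1 mulr1. Qed.

Lemma upper1 m : upper m 1 = 1.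
Proof. by rewrite /upper delannoym1 mul1r divff // gt_eqF ?options_gt0. Qed.

Lemma upper_ge0 m n : 0 <= upper m n.
Proof. by rewrite mulr_ge0 ?invr_ge0 ?exprn_ge0. Qed.

Lemma upper_homo m n : upper m n <= upper m n.+1.
Proof.
case: n => [|n]; first by rewrite upper0 upper1.
by rewrite upper_rec lerDl mulr_ge0 ?sqr_ge0 ?upper_ge0.
Qed.

Lemma upper_ge1 m n : 1 <= upper m n.
Proof.
elim: n => [|n IH]; first by rewrite upper0.
exact: le_trans IH (upper_homo m n).
Qed.

(** By monotonicity the older term of the recurrence may be replaced by the newer one. *)
Lemma upperS_le m n : upper m n.+1 <= (1 + (n%:R / (2 * m).+1%:R) ^+ 2) * upper m n.
Proof.
case: n => [|n]; first by rewrite upper0 upper1 mulr1 lerDl sqr_ge0.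
by rewrite upper_rec mulrDl mul1r lerD2l ler_wpM2l ?sqr_ge0 ?upper_homo.
Qed.

(** The one-step bounds 1 + a <= e^a multiply, and the squares below n^2 sum to at most n^3 / 3. *)
Lemma upper_le_expR m n : upper m n <= expR (n%:R ^+ 3 / (2 * m).+1%:R ^+ 2 / 3).
Proof.
have N0 := options_gt0 m; set N := (2 * m).+1%:R in N0 *.
elim: n => [|n IH]; first by rewrite upper0 expr0n /= !mul0r expR0.
apply: (le_trans (upperS_le m n)); rewrite -/N.
apply: (@le_trans _ _ (expR ((n%:R / N) ^+ 2 + n%:R ^+ 3 / N ^+ 2 / 3))).
  rewrite expRD ler_pM ?upper_ge0 ?expR_ge1Dx //.
  by rewrite addr_ge0 ?sqr_ge0.
have nS : n.+1%:R = n%:R + 1 :> R by rewrite natr1.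
rewrite ler_expR nS -subr_ge0.
have -> : (n%:R + 1) ^+ 3 / N ^+ 2 / 3 - ((n%:R / N) ^+ 2 + n%:R ^+ 3 / N ^+ 2 / 3)
  = (3 * n%:R + 1) / 3 / N ^+ 2 :> R by field; rewrite gt_eqF.
by rewrite divr_ge0 ?sqr_ge0 // divr_ge0 // addr_ge0 // mulr_ge0.
Qed.

(** Inverse of e^(-t) >= 1 - t at t = y / (1 + y). *)
Lemma expR_le1D (y : R) : 0 <= y -> expR (y / (1 + y)) <= 1 + y.
Proof.
move=> y0; have y1 : 0 < 1 + y by lra.
rewrite -[leRHS]invrK -[leLHS]invrK -expRN lef_pV2 ?posrE ?expR_gt0 ?invr_gt0 //.
apply: le_trans (expR_ge1Dx _).
rewrite -subr_ge0; have -> : 1 + - (y / (1 + y)) - (1 + y)^-1 = 0; last by [].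
by field; rewrite gt_eqF.
Qed.

(** The bound [L] is fixed during the induction, so one [A] controls all steps. The older term is at
    least the newer one over 1 + A, so each step gains a factor 1 + a / (1 + A) >= e^(a / (1 +
    2A)). *)
Lemma upper_ge_expR m L n : (n <= L)%N ->
  expR (n%:R ^+ 3 / (2 * m).+1%:R ^+ 2 / (3 * (1 + 2 * (L%:R / (2 * m).+1%:R) ^+ 2)))
  <= upper m n.+1.
Proof.
have N0 := options_gt0 m; set N := (2 * m).+1%:R in N0 *.
set A := (L%:R / N) ^+ 2; have A0 : 0 <= A by exact: sqr_ge0.
have aA k : (k <= L)%N -> (k%:R / N) ^+ 2 <= A.
  by move=> kL; rewrite ler_sqr ?nnegrE ?divr_ge0 ?(ltW N0) // ler_pM2r ?invr_gt0 // ler_nat.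
clearbody A.
have B0 : 0 < 1 + 2 * A by lra.
have C0 : 0 < 1 + A by lra.
have incr (a : R) : 0 <= a <= A -> expR (a / (1 + 2 * A)) <= 1 + a / (1 + A).
  move=> /andP[a0 leaA]; have y0 : 0 <= a / (1 + A) by rewrite divr_ge0 // ltW.
  apply: le_trans (expR_le1D _ y0); rewrite ler_expR.
  have -> : a / (1 + A) / (1 + a / (1 + A)) = a / (1 + A + a).
    by field; apply/andP; split; rewrite gt_eqF //; lra.
  by rewrite ler_wpM2l // lef_pV2 ?posrE; lra.
elim: n => [|n IH] nL; first by rewrite upper1 expr0n /= !mul0r expR0.
set a := (n.+1%:R / N) ^+ 2; have a0 : 0 <= a by exact: sqr_ge0.
apply: (@le_trans _ _ (expR (a / (1 + 2 * A)) * upper m n.+1)).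
  apply: le_trans (ler_wpM2l (expR_ge0 _) (IH (ltnW nL))).
  have nS : n.+1%:R = n%:R + 1 :> R by rewrite natr1.
  rewrite -expRD ler_expR -subr_ge0 /a nS; move: (1 + 2 * A) B0 => B B0.
  have -> : ((n%:R + 1) / N) ^+ 2 / B + n%:R ^+ 3 / N ^+ 2 / (3 * B)
      - (n%:R + 1) ^+ 3 / N ^+ 2 / (3 * B) = (3 * n%:R + 2) / (3 * B) / N ^+ 2.
    by field; apply/andP; split; rewrite gt_eqF.
  by rewrite divr_ge0 ?sqr_ge0 // divr_ge0 // ?addr_ge0 // mulr_ge0 // ltW.
have h1 : upper m n.+1 / (1 + A) <= upper m n.
  rewrite ler_pdivrMr // mulrC; apply: (le_trans (upperS_le m n)).
  by rewrite ler_wpM2r ?upper_ge0 // lerD2l aA // ltnW.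
rewrite upper_rec -/N -/a.
apply: (@le_trans _ _ ((1 + a / (1 + A)) * upper m n.+1)); last first.
  by rewrite mulrDl mul1r lerD2l -mulrA ler_wpM2l // mulrC.
by rewrite ler_wpM2r ?upper_ge0 // incr // a0 aA.
Qed.

(** * Exponential bounds for the alternating permutation *)

(** (4k^3 - k) / 3 is the sum of the first k odd squares. The hypothesis keeps the factors
    nonnegative, so that the bounds 1 - b <= e^(-b) multiply. *)
Lemma lower_prod_le m k :
  (forall i, (i < k)%N -> ((2 * i).+1 <= (2 * m).+1)%N) ->
  \prod_(i < k) (1 - ((2 * i).+1%:R / (2 * m).+1%:R) ^+ 2)
   <= expR (- ((4 * k%:R ^+ 3 - k%:R) / (2 * m).+1%:R ^+ 2 / 3)) :> R.
Proof.
have N0 := options_gt0 m.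
elim: k => [|k IH] kN; first by rewrite big_ord0 expr0n /= mulr0 subr0 !mul0r oppr0 expR0.
have {}IH := IH (fun i ik => kN i (ltnW ik)).
have bN := kN k (ltnSn k); rewrite big_ord_recr /=.
apply: (@le_trans _ _ (expR (- ((4 * k%:R ^+ 3 - k%:R) / (2 * m).+1%:R ^+ 2 / 3)) *
   expR (- ((2 * k).+1%:R / (2 * m).+1%:R) ^+ 2))).
  apply: ler_pM => //.
  - apply: prodr_ge0 => i _; rewrite subr_ge0 expr_le1 ?divr_ge0 //.
    by rewrite ler_pdivrMr // mul1r ler_nat kN // ltnS ltnW.
  - rewrite subr_ge0 expr_le1 ?divr_ge0 //.
    by rewrite ler_pdivrMr // mul1r ler_nat.
  - exact: expR_ge1Dx.
rewrite -expRD ler_expR.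
have -> : k.+1%:R = k%:R + 1 :> R by rewrite natr1.
have -> : (2 * k).+1%:R = 2 * k%:R + 1 :> R by rewrite -natr1 natrM.
move: (2 * m).+1%:R N0 => N N0; rewrite le_eqVlt; apply/orP; left; apply/eqP.
by field; rewrite gt_eqF.
Qed.

Lemma lower_prod_ge m k (A : R) : 0 <= A < 1 ->
  (forall i, (i < k)%N -> ((2 * i).+1%:R / (2 * m).+1%:R) ^+ 2 <= A) ->
  expR (- ((4 * k%:R ^+ 3 - k%:R) / (2 * m).+1%:R ^+ 2 / (3 * (1 - A))))
  <= \prod_(i < k) (1 - ((2 * i).+1%:R / (2 * m).+1%:R) ^+ 2).
Proof.
move=> /andP[A0 A1]; have N0 := options_gt0 m.
elim: k => [|k IH] kA; first by rewrite big_ord0 expr0n /= mulr0 subr0 !mul0r oppr0 expR0.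
have {}IH := IH (fun i ik => kA i (ltnW ik)).
have := kA k (ltnSn k); rewrite big_ord_recr /=.
set b := ((2 * k).+1%:R / (2 * m).+1%:R) ^+ 2 => bA; have b0 : 0 <= b by exact: sqr_ge0.
(* Inverting, 1 / (1 - b) = 1 + b / (1 - b) <= 1 + b / (1 - A) <= e^(b / (1 - A)). *)
have eb : expR (- (b / (1 - A))) <= 1 - b.
  have b1 : 0 < 1 - b by lra.
  rewrite -[leRHS]invrK expRN lef_pV2 ?posrE ?expR_gt0 ?invr_gt0 //.
  apply: le_trans (expR_ge1Dx _).
  apply: (@le_trans _ _ (1 + b / (1 - b))).
    by rewrite le_eqVlt; apply/orP; left; apply/eqP; field; rewrite gt_eqF.
  by rewrite lerD2l ler_wpM2l // lef_pV2 ?posrE; lra.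
apply: le_trans (ler_pM (expR_ge0 _) (expR_ge0 _) IH eb).
rewrite -expRD ler_expR /b.
have -> : k.+1%:R = k%:R + 1 :> R by rewrite natr1.
have -> : (2 * k).+1%:R = 2 * k%:R + 1 :> R by rewrite -natr1 natrM.
move: (2 * m).+1%:R N0 => N N0; rewrite le_eqVlt; apply/orP; left; apply/eqP.
by field; apply/andP; split; rewrite gt_eqF //; lra.
Qed.

End Normalised.

(** * Limits for m close to c n^(3/2) *)

Local Open Scope classical_set_scope.

Section Limits.
Variables (R : realType) (c : R).
Hypothesis c0 : 0 < c.

Let m n := m_of c n.+1.
Let N n : R := (2 * m n).+1%:R.
Let T n : R := n.+1%:R ^+ 3 / N n ^+ 2.
Let h : R ^nat := harmonic.

(** Truncation leaves N within 1 of 2c (n+1)^(3/2); after division by (n+1)^(3/2) the error is at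
    most 1/(n+1). *)
Lemma cvg_cube_ratio : T @ \oo --> (2 * c)^-1 ^+ 2.
Proof.
pose x n : R := n.+1%:R `^ (3 / 2).
have x2 n : x n ^+ 2 = n.+1%:R ^+ 3.
  rewrite /x -powR_mulrn ?powR_ge0 // -powRrM -[RHS]powR_mulrn //.
  by congr (_ `^ _); field.
have xn n : n.+1%:R <= x n.
  rewrite /x -[leLHS]powRr1 //; apply: ler_powR; first by rewrite ler1n.
  by rewrite ler_pdivlMr // mul1r ler_nat.
have x0 n : 0 < x n by apply: lt_le_trans (xn n); rewrite ltr0n.
have Nx n : 2 * c - h n <= N n / x n <= 2 * c + h n.
  have cx0 : 0 <= c * x n by rewrite mulr_ge0 // ltW.
  have /andP[] := truncn_itv cx0.
  rewrite -/(m_of c n.+1) -/(m n) -natr1 => h1 h2.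
  have NE : N n = 2 * (m n)%:R + 1 by rewrite /N -natr1 natrM.
  have hx : 1 <= h n * x n.
    by rewrite /h /harmonic /= mulrC ler_pdivlMr ?ltr0n // mul1r.
  by rewrite ler_pdivlMr // ler_pdivrMr // NE mulrBl mulrDl; lra.
have cN : N n / x n @[n --> \oo] --> 2 * c.
  apply: (@squeeze_cvgr _ _ _ _ (fun n => 2 * c - h n) (fun n => 2 * c + h n)).
  - by near=> n; exact: Nx.
  - by rewrite -[X in _ --> X]subr0; apply: cvgB; [exact: cvg_cst|exact: cvg_harmonic].
  - by rewrite -[X in _ --> X]addr0; apply: cvgD; [exact: cvg_cst|exact: cvg_harmonic].
have c20 : 2 * c != 0 by rewrite mulf_neq0 // gt_eqF.
have cV : (N n / x n)^-1 @[n --> \oo] --> (2 * c)^-1 by exact: cvgV.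
have cV2 : (N n / x n)^-1 * (N n / x n)^-1 @[n --> \oo] --> (2 * c)^-1 ^+ 2 by exact: cvgM.
apply: cvg_trans cV2; apply: near_eq_cvg.
near=> n; rewrite /= /T -x2.
have := options_gt0 R (m n); rewrite -/(N n) => N0; move: (x n) (x0 n) (N n) N0 => y y0 M M0.
by field; rewrite !gt_eqF.
Unshelve. all: by end_near.
Qed.

Let tau := (2 * c)^-1 ^+ 2.

Lemma cvg_h : h @ \oo --> (0 : R). Proof. exact: cvg_harmonic. Qed.

Lemma cvg_Th : T n * h n @[n --> \oo] --> (0 : R).
Proof.
rewrite -[X in _ --> X](mulr0 tau).
by apply: cvgM; [exact: cvg_cube_ratio|exact: cvg_h].
Qed.

Lemma cvg_linear_cube (a : R) : (1 - a * h n) ^+ 3 @[n --> \oo] --> (1 : R).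
Proof.
have h1 : 1 - a * h n @[n --> \oo] --> (1 : R).
  rewrite -[X in _ --> X]subr0 -(mulr0 a); apply: cvgB; first exact: cvg_cst.
  by apply: cvgM; [exact: cvg_cst|exact: cvg_h].
have h3 : (1 - a * h n) * (1 - a * h n) * (1 - a * h n) @[n --> \oo] --> (1 * 1 * 1 : R).
  by apply: cvgM; [apply: cvgM|].
rewrite !mulr1 in h3; apply: cvg_trans h3; apply: near_eq_cvg.
by near=> n; rewrite !exprS expr0 mulr1 mulrA.
Unshelve. all: by end_near.
Qed.

Lemma ratioE n : (n.+1%:R / N n) ^+ 2 = T n * h n.
Proof.
have := options_gt0 R (m n); rewrite -/(N n) => N0.
rewrite /T /h /harmonic /=; have := ltr0Sn R n; move: n.+1%:R (N n) N0 => y M M0 y0.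
by field; rewrite !gt_eqF.
Qed.

Lemma cubeE n (a : R) : (n.+1%:R - a) ^+ 3 / N n ^+ 2 = T n * (1 - a * h n) ^+ 3.
Proof.
have := options_gt0 R (m n); rewrite -/(N n) => N0.
rewrite /T /h /harmonic /=; have := ltr0Sn R n; move: n.+1%:R (N n) N0 => y M M0 y0.
by field; rewrite !gt_eqF.
Qed.

Lemma cvg_expR (f : R ^nat) (l : R) : f @ \oo --> l -> expR (f n) @[n --> \oo] --> expR l.
Proof. by move=> fl; apply: continuous_cvg => //; exact: continuous_expR. Qed.

Lemma cvg_upper : upper R (m n) n.+1 @[n --> \oo] --> expR (tau / 3).
Proof.
apply: (@squeeze_cvgr _ _ _ _
  (fun n => expR (T n * (1 - 1 * h n) ^+ 3 / (3 * (1 + 2 * (T n * h n)))))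
  (fun n => expR (T n / 3))).
- near=> n; rewrite upper_le_expR andbT.
  (* With [L] = n + 1 the error parameter is [T n * h n], which tends to 0. *)
  have := upper_ge_expR R (m n) n.+1 n (leqnSn n).
  rewrite -/(N n) ratioE.
  have {1}-> : n%:R = n.+1%:R - 1 :> R by rewrite -natr1 addrK.
  by rewrite cubeE.
- have -> : tau / 3 = tau * 1 / (3 * (1 + 2 * 0)) by rewrite mulr0 addr0 !mulr1.
  apply: cvg_expR.
  apply: cvgM; first by apply: cvgM; [exact: cvg_cube_ratio|exact: cvg_linear_cube].
  apply: cvgV; first by rewrite mulr0 addr0 mulr1.
  apply: cvgM; first exact: cvg_cst.
  by apply: cvgD; [exact: cvg_cst|apply: cvgM; [exact: cvg_cst|exact: cvg_Th]].
- by apply: cvg_expR; apply: cvgM; [exact: cvg_cube_ratio|exact: cvg_cst].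
Unshelve. all: by end_near.
Qed.

(** For k = (n+1)./2, 2k is n or n + 1 and 4k^3 = (2k)^3 / 2; the shift by 2 absorbs the parity and
    the linear term. *)
Lemma half_cube_bounds n :
  (n.+1%:R - 2) ^+ 3 / 2 <= 4 * (n.+1)./2%:R ^+ 3 - (n.+1)./2%:R :> R /\
  4 * (n.+1)./2%:R ^+ 3 - (n.+1)./2%:R <= n.+1%:R ^+ 3 / 2 :> R.
Proof.
have : n.+1%:R = (odd n.+1)%:R + 2 * (n.+1)./2%:R :> R.
  by rewrite -natrM -natrD mul2n odd_double_half.
move: (odd n.+1) (n.+1)./2 => b k ->.
have k0 : 0 <= k%:R :> R by [].
(* Integrality matters: for odd n + 1 the lower bound would fail for real k between 1/6 and 1/2. *)
have k2 : k = 0%N \/ 1 <= k%:R :> R by case: k {k0} => [|k]; [left|right; rewrite ler1n].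
move: k2; case: b => /= -[->|k1]; rewrite ?mulr0 ?addr0 ?add0r; try lra.
- split; nra.
- split; nra.
Qed.

(** By [ratioE] the hypothesis means n + 1 < N, so the factors are positive and [T n * h n] can
    serve as [A]. *)
Lemma lower_bounds n : T n * h n < 1 ->
  expR (- (T n / 2 / (3 * (1 - T n * h n)))) <= lower R (m n) n.+1
  <= expR (- (T n * (1 - 2 * h n) ^+ 3 / 2 / 3)).
Proof.
move=> A1; have := options_gt0 R (m n); rewrite -/(N n) => N0.
have N20 : 0 < N n ^+ 2 by rewrite exprn_gt0.
have A0 : 0 <= T n * h n by rewrite -ratioE sqr_ge0.
have nN : (n.+1 <= (2 * m n).+1)%N.
  move: A1; rewrite -ratioE expr_lt1 ?divr_ge0 ?(ltW N0) // ltr_pdivrMr // mul1r ltr_nat.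
  exact: ltnW.
have [b1 b2] := half_cube_bounds n.
apply/andP; split.
- apply: (le_trans _ (@lower_prod_ge R (m n) (n.+1)./2 (T n * h n) _ _)).
  + rewrite ler_expR lerN2 ler_pM2r ?invr_gt0; last by lra.
    by rewrite -/(N n) /T ler_pdivrMr // mulrAC divfK ?gt_eqF.
  + by rewrite A0.
  + move=> i ik; rewrite -ratioE ler_sqr ?nnegrE ?divr_ge0 ?(ltW N0) //.
    by rewrite ler_pM2r ?invr_gt0 // ler_nat; lia.
- apply: le_trans (@lower_prod_le R (m n) (n.+1)./2 _) _; first by lia.
  rewrite ler_expR lerN2 -/(N n) ler_pM2r ?invr_gt0 // -cubeE.
  by rewrite ler_pdivlMr // mulrAC divfK ?gt_eqF.
Qed.

Lemma near_Th_lt1 : \forall n \near \oo, T n * h n < 1.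
Proof. exact: (cvgr_lt _ cvg_Th). Qed.

Lemma cvg_lower : lower R (m n) n.+1 @[n --> \oo] --> expR (- (tau / 2 / 3)).
Proof.
apply: (@squeeze_cvgr _ _ _ _
  (fun n => expR (- (T n / 2 / (3 * (1 - T n * h n)))))
  (fun n => expR (- (T n * (1 - 2 * h n) ^+ 3 / 2 / 3)))).
- by apply: filterS near_Th_lt1 => n; exact: lower_bounds.
- have -> : tau / 2 / 3 = tau / 2 / (3 * (1 - 0)) by rewrite subr0 mulr1.
  apply: cvg_expR; apply: cvgN.
  apply: cvgM; first by apply: cvgM; [exact: cvg_cube_ratio|exact: cvg_cst].
  apply: cvgV; first by rewrite subr0 mulr1.
  apply: cvgM; first exact: cvg_cst.
  by apply: cvgB; [exact: cvg_cst|exact: cvg_Th].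
- apply: cvg_expR; apply: cvgN; apply: cvgM; last exact: cvg_cst.
  apply: cvgM; last exact: cvg_cst.
  rewrite -[X in _ --> X]mulr1.
  by apply: cvgM; [exact: cvg_cube_ratio|exact: cvg_linear_cube].
Qed.

Lemma lower_le1 n : T n * h n < 1 -> lower R (m n) n.+1 <= 1.
Proof.
move=> A1; have := options_gt0 R (m n); rewrite -/(N n) => N0.
have : n.+1%:R / N n < 1.
  by move: A1; rewrite -ratioE expr_lt1 // divr_ge0 // ltW.
rewrite ltr_pdivrMr // mul1r ltr_nat => nN.
apply: prodr_ile1 => i _; rewrite lerBlDr lerDl sqr_ge0 andbT subr_ge0.
rewrite expr_le1 ?divr_ge0 // ler_pdivrMr // mul1r ler_nat.
by have := ltn_ord i; lia.
Qed.

Lemma cvg_sep : sep_dist (@shelf_prob R n.+1 (m n)) @[n --> \oo] --> 1 - expR (- (tau / 2 / 3)).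
Proof.
have cl : 1 - lower R (m n) n.+1 @[n --> \oo] --> 1 - expR (- (tau / 2 / 3)).
  by apply: cvgB; [exact: cvg_cst|exact: cvg_lower].
apply: cvg_trans cl; apply: near_eq_cvg.
by apply: filterS near_Th_lt1 => n A1; rewrite sep_shelf ?lower_le1.
Qed.

Lemma cvg_linf : linf_dist (@shelf_prob R n.+1 (m n)) @[n --> \oo] --> expR (tau / 3) - 1.
Proof.
have -> : expR (tau / 3) - 1 = Num.max (expR (tau / 3) - 1) (1 - expR (- (tau / 2 / 3))).
  (* Indeed e^(tau/3) - 1 >= tau/3 >= tau/6 >= 1 - e^(-tau/6). *)
  apply/esym/max_idPl.
  have t0 : 0 <= tau by exact: sqr_ge0.
  have := expR_ge1Dx (tau / 3); have := expR_ge1Dx (- (tau / 2 / 3)); lra.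
have cu : upper R (m n) n.+1 - 1 @[n --> \oo] --> expR (tau / 3) - 1.
  by apply: cvgB; [exact: cvg_upper|exact: cvg_cst].
have cl : 1 - lower R (m n) n.+1 @[n --> \oo] --> 1 - expR (- (tau / 2 / 3)).
  by apply: cvgB; [exact: cvg_cst|exact: cvg_lower].
have cm : Num.max (upper R (m n) n.+1 - 1) (1 - lower R (m n) n.+1) @[n --> \oo] -->
    Num.max (expR (tau / 3) - 1) (1 - expR (- (tau / 2 / 3))).
  exact: (cvg_comp _ _ (cvg_pair cu cl) (@max_continuous _ R (_, _))).
apply: cvg_trans cm; apply: near_eq_cvg.
by apply: filterS near_Th_lt1 => n A1; rewrite linf_shelf ?lower_le1 ?upper_ge1.
Qed.
End Limits.

Theorem theorem4p2 (R : realType) (c : R) (hc : 0 < c) :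
  ((fun n : nat => linf_dist (@shelf_prob R n (m_of c n))
                   / (expR (1 / (12 * c ^+ 2)) - 1)) @ \oo --> (1%R : R^o))
  /\
  ((fun n : nat => sep_dist (@shelf_prob R n (m_of c n))
                   / (1 - expR (- (1 / (24 * c ^+ 2))))) @ \oo --> (1%R : R^o)).
Proof.
have e1 : (2 * c)^-1 ^+ 2 / 3 = 1 / (12 * c ^+ 2) by field; rewrite gt_eqF.
have e2 : (2 * c)^-1 ^+ 2 / 2 / 3 = 1 / (24 * c ^+ 2) by field; rewrite gt_eqF.
(* The limits above are stated for decks of n + 1 cards. *)
split; rewrite -cvg_shiftS.
- have d0 : expR (1 / (12 * c ^+ 2)) - 1 != 0.
    by rewrite gt_eqF // subr_gt0 expR_gt1 divr_gt0 // mulr_gt0 // exprn_gt0.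
  have cl := cvg_linf R c hc; rewrite e1 in cl.
  by have := cvgM cl (cvg_cst (expR (1 / (12 * c ^+ 2)) - 1)^-1); rewrite divff //; exact.
- have d0 : 1 - expR (- (1 / (24 * c ^+ 2))) != 0.
    by rewrite gt_eqF // subr_gt0 expR_lt1 oppr_lt0 divr_gt0 // mulr_gt0 // exprn_gt0.
  have cs := cvg_sep R c hc; rewrite e2 in cs.
  by have := cvgM cs (cvg_cst (1 - expR (- (1 / (24 * c ^+ 2))))^-1); rewrite divff //; exact.
Qed.
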